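(* Let $n\ge 2$ and $k \ge n+2$. For any full $k$-coloring $\Gamma:\mathbb{S}^n\to\{1,\dots,k\}$ of the standard $n$-sphere, there exists a great $(n-1)$-sphere $S\subset\mathbb{S}^n$ that contains at least $n+1$ different colors, i.e. $|\Gamma(S)|\ge n+1$.
   Context: The standard $n$-sphere is $\mathbb{S}^n = \{(x_0,\dots,x_n)\in\mathbb{R}^{n+1} : \sum_{i=0}^n x_i^2 = 1\}$. A full $k$-coloring of $\mathbb{S}^n$ is a surjective map $\Gamma:\mathbb{S}^n\to\{1,\dots,k\}$; no continuity, measurability or other regularity is assumed. A great $(n-1)$-sphere is the intersection of $\mathbb{S}^n$ with a hyperplane of $\mathbb{R}^{n+1}$ passing through the origin (an $n$-dimensional linear subspace). *)

(* Defs.v *)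
From mathcomp Require Import all_boot all_order all_algebra.
From mathcomp Require Import all_classical all_reals.

Set Implicit Arguments.
Unset Strict Implicit.
Unset Printing Implicit Defensive.

Import Order.TTheory GRing.Theory Num.Theory.

Local Open Scope classical_set_scope.
Local Open Scope ring_scope.

Definition sphere (R : realType) (n : nat) : set 'rV[R]_n.+1 :=
  [set x : 'rV[R]_n.+1 | \sum_(i < n.+1) x ord0 i ^+ 2 = 1].

Arguments sphere : clear implicits.

(* The colors 1, ..., k are represented by 'I_k. *)
Definition full_coloring (R : realType) (n k : nat)
    (Gamma : sphere R n -> 'I_k) : Prop :=
  set_surj [set: sphere R n] [set: 'I_k] Gamma.

Definition great_sphere (R : realType) (n : nat)
    (S : set (sphere R n)) : Prop :=
  exists2 V : {vspace 'rV[R]_n.+1},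
    \dim V = n & S = [set x : sphere R n | set_val x \in V].

(* Main.v *)
Require Import Defs.
From mathcomp Require Import all_boot all_order all_algebra.
From mathcomp Require Import all_classical all_reals.

(** Suppose that some point [x] of the sphere lies in a subspace spanned by points
of at most [n] distinct colors, none of which is the color of [x]. Adding points
of further colors until [n] spanning colors are reached gives a subspace of
dimension at most [n], hence a great sphere, that carries these [n] colors and
the color of [x]: the conclusion holds ([new_color_in_span]). In particular it
holds as soon as some [n + 1] or fewer points of distinct colors are linearly
dependent ([dependent_colors]).

Now choose points of [n + 2] distinct colors and split them into a pair and a
family of [n] points. One may assume that both are linearly independent. They
then span subspaces of dimensions [2] and [n] in a space of dimension [n + 1],
so the spans share a point [x] of the sphere. The color of [x] is missing from
one of the two disjoint sets of colors, and [new_color_in_span] applies to the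
span of that part. It needs both parts to have at most [n] colors, which for the
pair is the hypothesis [2 <= n]: for [n = 1] the great spheres are antipodal
pairs, and an antipodally symmetric coloring is a counterexample. *)

Set Implicit Arguments.
Unset Strict Implicit.
Unset Printing Implicit Defensive.

Import Order.TTheory GRing.Theory Num.Theory.

Local Open Scope classical_set_scope.
Local Open Scope ring_scope.

Lemma subspace_between (K : fieldType) (vT : vectType K) (U : {vspace vT})
    (m : nat) :
  (\dim U <= m <= \dim {:vT})%N ->
  exists2 V : {vspace vT}, (U <= V)%VS & \dim V = m.
Proof.
move=> /andP[dU dm].
pose W := <<take (m - \dim U) (vbasis U^C)>>%VS.
have fW : free (take (m - \dim U) (vbasis U^C)).
  have := basis_free (vbasisP U^C).
  rewrite -{1}(cat_take_drop (m - \dim U) (vbasis U^C)); exact: catl_free.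
have sW : (W <= U^C)%VS.
  by apply/span_subvP => v /mem_take; apply: vbasis_mem.
exists (U + W)%VS; first exact: addvSl.
have UW0 : (U :&: W = 0)%VS.
  by apply/eqP; rewrite -subv0 -(capv_compl U); apply: capvS.
rewrite dimv_disjoint_sum // (eqnP fW) size_takel ?subnKC //.
by rewrite size_tuple dimv_compl leq_sub2r.
Qed.

Lemma uniq_extend (T : finType) (s : seq T) (m : nat) :
  uniq s -> (size s <= m <= #|T|)%N ->
  exists2 s' : seq T, uniq (s ++ s') & size (s ++ s') = m.
Proof.
move=> us /andP[sm mT].
pose r := [seq x <- enum T | x \notin s].
have sr : (size r = #|T| - size s)%N.
  rewrite -(card_uniqP us) -(cardC (mem s)) addKn cardE /enum_mem.
  by rewrite /r enumT; congr size; apply: eq_filter => x.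
exists (take (m - size s) r).
  have tr : uniq (take (m - size s) r)
    by exact/take_uniq/filter_uniq/enum_uniq.
  rewrite cat_uniq us tr andbT /=.
  by apply/hasPn => x /mem_take; rewrite mem_filter => /andP[].
by rewrite size_cat size_takel ?subnKC // sr leq_sub2r.
Qed.

Lemma card_ge_uniq (T : eqType) (A : set T) (s : seq T) :
  uniq s -> {in s, forall c, A c} -> (`I_(size s) #<= A)%card.
Proof.
case: s => [|c0 s'] us sA; first by rewrite II0 card_ge0.
apply/pcard_surjP; exists (index^~ (c0 :: s')) => i /= ilt.
exists (nth c0 (c0 :: s') i); first exact/sA/mem_nth.
exact: (@index_uniq T c0 i (c0 :: s')).
Qed.

Lemma sphere_in_nonzero_subspace (R : realType) (n : nat)
    (U : {vspace 'rV[R]_n.+1}) :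
  U != 0%VS -> exists x : sphere R n, set_val x \in U.
Proof.
rewrite -vpick0; set v := vpick U => v0.
pose s := \sum_(i < n.+1) v ord0 i ^+ 2.
have s_ge0 : 0 <= s by apply: sumr_ge0 => i _; apply: sqr_ge0.
have s_neq0 : s != 0.
  apply: contra_neq v0 => s0; apply/rowP => i; rewrite mxE.
  apply/eqP; rewrite -sqrf_eq0; apply/eqP/(psumr_eq0P _ s0) => // j _.
  exact: sqr_ge0.
pose w := (Num.sqrt s)^-1 *: v.
have wS : sphere R n w.
  rewrite /sphere /=; under eq_bigr do rewrite mxE exprMn.
  by rewrite -mulr_sumr exprVn sqr_sqrtr // mulVf.
by exists (SigSub (mem_set wS)); rewrite memvZ // memv_pick.
Qed.

(** The color of [x] comes for free, as [x] already lies in the span: this is how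
a subspace of dimension [n] acquires one color more than its dimension. *)
Lemma new_color_in_span (R : realType) (n k : nat) (Gamma : sphere R n -> 'I_k)
    (p : 'I_k -> sphere R n) (t : seq 'I_k) (x : sphere R n) :
  (n + 1 <= k)%N -> cancel p Gamma -> uniq t -> (size t <= n)%N ->
  set_val x \in <<[seq set_val (p c) | c <- t]>>%VS -> Gamma x \notin t ->
  exists2 S : set (sphere R n),
    great_sphere S & (`I_(n.+1) #<= Gamma @` S)%card.
Proof.
move=> nk pK ut tn xt Gxt.
(* Choosing the new colors away from [Gamma x] too makes [t ++ u] a list of
   exactly [n] colors. *)
have [||u uu su] := @uniq_extend 'I_k (Gamma x :: t) n.+1.
- by rewrite /= Gxt.
- by rewrite /= ltnS tn card_ord -addn1.
pose q := [seq set_val (p c) | c <- t ++ u].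
have [|V qV dV] := @subspace_between R _ <<q>>%VS n.
  rewrite dimvf /dim /= mul1n leqnSn andbT (leq_trans (dim_span _)) //.
  by rewrite size_map -ltnS -su.
exists [set y | set_val y \in V]; first by exists V.
suff: (`I_(size ((Gamma x :: t) ++ u)) #<=
       Gamma @` [set y | set_val y \in V])%card.
  by rewrite su.
apply: card_ge_uniq => // c.
rewrite /= inE => /predU1P[-> | ctu].
  exists x => //=; apply: subvP qV _ _; apply: subvP xt.
  by apply: sub_span => v; rewrite /q map_cat mem_cat => ->.
exists (p c) => //=; apply: subvP qV _ _; apply: memv_span.
by apply: (map_f (fun c => set_val (p c))).
Qed.

(** One of the points lies in the span of those after it, whose colors differ from
its own. *)
Lemma dependent_colors (R : realType) (n k : nat) (Gamma : sphere R n -> 'I_k)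
    (p : 'I_k -> sphere R n) (t : seq 'I_k) :
  (n + 1 <= k)%N -> cancel p Gamma -> uniq t -> (size t <= n.+1)%N ->
  ~~ free [seq set_val (p c) | c <- t] ->
  exists2 S : set (sphere R n),
    great_sphere S & (`I_(n.+1) #<= Gamma @` S)%card.
Proof.
move=> nk pK; elim: t => [|c t IHt] /=; first by rewrite nil_free.
move=> /andP[ct ut] tn; rewrite free_cons negb_and negbK => /orP[pct|].
  by apply: (new_color_in_span nk pK ut tn pct); rewrite pK.
exact/IHt/ltnW.
Qed.

Theorem theorem1p3 (R : realType) (n k : nat) (hn : (2 <= n)%N)
    (hk : (n + 2 <= k)%N) (Gamma : sphere R n -> 'I_k)
    (hGamma : full_coloring Gamma) :
  exists2 S : set (sphere R n),
    great_sphere S & (`I_(n.+1) #<= Gamma @` S)%card.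
Proof.
have [p pK] : exists p : 'I_k -> sphere R n, cancel p Gamma.
  have fiber c : exists x, Gamma x = c by have [x _ <-] := hGamma c I; exists x.
  by have [p pK] := choice fiber; exists p.
have nk : (n + 1 <= k)%N by apply: leq_trans hk; rewrite leq_add2l.
have [|r ur sr] := @uniq_extend 'I_k [::] n.+2 isT.
  by rewrite card_ord -addn2.
rewrite /= in ur sr.
pose s := take 2 r; pose t := drop 2 r.
have ss : size s = 2 by rewrite size_takel // sr.
have st : size t = n by rewrite size_drop sr subn2.
move: ur; rewrite -(cat_take_drop 2 r) cat_uniq -/s -/t => /and3P[us disj ut].
pose span_of c := <<[seq set_val (p i) | i <- c]>>%VS : {vspace 'rV[R]_n.+1}.
have [fs|] := boolP (free [seq set_val (p i) | i <- s]); last first.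
  by apply: (dependent_colors nk pK us); rewrite ss ltnS ltnW.
have [ft|] := boolP (free [seq set_val (p i) | i <- t]); last first.
  by apply: (dependent_colors nk pK ut); rewrite st.
(* A trivial intersection would make the sum of dimension [n + 2]. *)
have : (span_of s :&: span_of t)%VS != 0%VS.
  have := dimv_sum_cap (span_of s) (span_of t).
  rewrite (eqnP fs) (eqnP ft) !size_map ss st => dim_eq.
  apply/eqP => meet0; move: dim_eq (dimvS (subvf (span_of s + span_of t)%VS)).
  by rewrite meet0 dimv0 addn0 dimvf /dim /= mul1n => ->; rewrite ltnn.
move=> /sphere_in_nonzero_subspace[x]; rewrite memv_cap => /andP[xs xt].
have [Gt|Gt] := boolP (Gamma x \in t).
  apply: (new_color_in_span nk pK us _ xs); first by rewrite ss.
  by apply: contra disj => Gs; apply/hasP; exists (Gamma x).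
by apply: (new_color_in_span nk pK ut _ xt Gt); rewrite st.
Qed.
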